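(* Let $M>0$ and $2<p\le\infty$. Then there exist unitary operators $U_1,U_2,V$ on a Hilbert space and an analytic polynomial $f$ in two variables such that $$\|f(U_1,V)-f(U_2,V)\|_{\boldsymbol{S}_p}>M\,\|f\|_{B^1_{\infty,1}(\mathbb{T}^2)}\,\|U_1-U_2\|_{\boldsymbol{S}_p}.$$
   Context: $\|\cdot\|_{\boldsymbol{S}_p}$ is the Schatten--von Neumann norm (equal to $\infty$ for operators outside $\boldsymbol{S}_p$), and $\|\cdot\|_{\boldsymbol{S}_\infty}$ denotes the operator norm. An analytic polynomial in two variables is $f(z,w)=\sum_{j,k\ge0}\widehat f(j,k)z^jw^k$ (finite sum), and for not necessarily commuting operators $f(U,V)=\sum_{j,k}\widehat f(j,k)U^jV^k$. Besov norm. Fix an infinitely differentiable function $w\ge 0$ on $\mathbb{R}$ with $\operatorname{supp}w\subset[1/2,2]$ and $w(s)=1-w(s/2)$ for $s\in[1,2]$. For $j=(j_1,j_2)\in\mathbb{Z}^2$ let $|j|=(j_1^2+j_2^2)^{1/2}$ and $\zeta^j=\zeta_1^{j_1}\zeta_2^{j_2}$. Put $W_n(\zeta)=\sum_{j\in\mathbb{Z}^2}w(|j|/2^n)\zeta^j$ for $n\ge1$ and $W_0(\zeta)=\sum_{|j|\le1}\zeta^j+\sum_{1<|j|<2}w(|j|)\zeta^j$, $\zeta\in\mathbb{T}^2$. With $f_n=f*W_n$, $n\ge0$, one has $f=\sum_{n\ge0}f_n$, and $\|f\|_{B_{\infty,1}^1(\mathbb{T}^2)}:=\sum_{n\ge0}2^n\|f_n\|_{L^\infty(\mathbb{T}^2)}$.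 *)

(* Defs.v *)
From HB Require Import structures.
From mathcomp Require Import all_boot all_order all_algebra polyXY sesquilinear.
From mathcomp Require Import complex.
From mathcomp Require Import all_classical all_reals all_analysis.

Set Implicit Arguments.
Unset Strict Implicit.
Unset Printing Implicit Defensive.

Import Order.TTheory GRing.Theory Num.Theory.
Import numFieldNormedType.Exports.

Local Open Scope classical_set_scope.
Local Open Scope complex_scope.
Local Open Scope ring_scope.

(* A complex Hilbert space: a complex Banach space whose norm comes from an
   inner product (linear on the left, conjugate-linear on the right). *)
Record hilbertSpace (R : realType) := HilbertSpace {
  hilbert_sort :> completeNormedModType R[i] ;
  hdot : {dot hilbert_sort for (@Num.conj R[i])} ;
  hdotE : forall x : hilbert_sort, `|x| ^+ 2 = hdot x x }.

Section Operators.
Context {R : realType} {H : hilbertSpace R}.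
Implicit Types (T : H -> H) (U V : {linear H -> H}).

Definition unitary U :=
  (forall x y, hdot H (U x) (U y) = hdot H x y) /\ (forall y, exists x, U x = y).

(* Norms are elements of R[i] (nonnegative reals), hence the projection. *)
Definition opnorm T : \bar R :=
  ereal_sup [set (complex.Re `|T x|)%:E | x in [set x : H | `|x| <= 1]].

Definition rank_le (n : nat) T :=
  exists v : 'I_n -> H, forall x,
  exists c : 'I_n -> R[i], T x = \sum_(i < n) c i *: v i.

(* Unbounded K contribute +oo when T is bounded, so they are harmless. *)
Definition singular_number T (n : nat) : \bar R :=
  ereal_inf [set opnorm (fun x => T x - K x) |
             K in [set K : {linear H -> H} | rank_le n K]].

(* Meant for 0 < p <= +oo. *)
Definition schatten_norm (p : \bar R) T : \bar R :=
  match p with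
  | r%:E => ((\sum_(0 <= n <oo) (singular_number T n `^ r)) `^ r^-1)%E
  | _ => opnorm T
  end.

(* The coefficient of z^j w^k in f is f`_j`_k, as in polyXY's f.[z, w]. *)
Definition poly_op (f : {poly {poly R[i]}}) U V : H -> H := fun x =>
  \sum_(j < size f) \sum_(k < size f`_j) f`_j`_k *: iter j U (iter k V x).

End Operators.

Section Torus.
Context {R : realType}.

Definition circle (t : R) : R[i] := cos (2 * pi * t) +i* sin (2 * pi * t).

(* Normalized Haar measure of T^2 in the coordinates (circle s, circle t),
   0 <= s, t <= 1. *)
Definition torus_measure :=
  (uniform_prob (@ltr01 R) \x uniform_prob (@ltr01 R))%E.

Definition torus_integral (g : R[i] -> R[i] -> R[i]) : R[i] :=
  (\int[torus_measure]_t complex.Re (g (circle t.1) (circle t.2))) +i*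
  (\int[torus_measure]_t complex.Im (g (circle t.1) (circle t.2))).

Definition torus_conv (g h : R[i] -> R[i] -> R[i]) : R[i] -> R[i] -> R[i] :=
  fun z1 z2 => torus_integral (fun u1 u2 => g u1 u2 * h (z1 / u1) (z2 / u2)).

Definition torus_Linfty (g : R[i] -> R[i] -> R[i]) : \bar R :=
  ('N[torus_measure]_+oo[
     (fun t => (complex.Re `|g (circle t.1) (circle t.2)|)%:E)])%E.

End Torus.

Section Besov.
Context {R : realType}.
Implicit Types (w : R -> R) (j : int * int).

Definition besov_window w :=
  [/\ forall n x, derivable (derive1n n w) x 1,
      forall s, 0 <= w s,
      closure [set s | w s != 0] `<=` `[2^-1, 2] &
      forall s, 1 <= s <= 2 -> w s = 1 - w (s / 2)].

Definition absZ2 j : R := Num.sqrt ((j.1%:~R) ^+ 2 + (j.2%:~R) ^+ 2).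

Definition monomZ2 j (z1 z2 : R[i]) : R[i] := z1 ^ j.1 * z2 ^ j.2.

Definition besov_kernel w (n : nat) (z1 z2 : R[i]) : R[i] :=
  if n is 0%N then
    \sum_(j \in [set j | absZ2 j <= 1]) monomZ2 j z1 z2 +
    \sum_(j \in [set j | 1 < absZ2 j < 2]) (w (absZ2 j))%:C * monomZ2 j z1 z2
  else
    \sum_(j \in [set: int * int]) (w (absZ2 j / 2 ^+ n))%:C * monomZ2 j z1 z2.

Definition besov_norm w (f : {poly {poly R[i]}}) : \bar R :=
  (\sum_(0 <= n <oo)
     (2 ^+ n)%:E *
     torus_Linfty (torus_conv (fun z1 z2 => f.[z1, z2]) (besov_kernel w n)))%E.

End Besov.

(* Main.v *)
Require Import Defs.
From HB Require Import structures.
From mathcomp Require Import all_boot all_order all_algebra sesquilinear.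
From mathcomp Require Import complex.
From mathcomp Require Import all_classical all_reals all_analysis.
From mathcomp Require Import measurable_realfun ess_sup_inf.
From mathcomp Require Import ring lra zify.

Set Implicit Arguments.
Unset Strict Implicit.
Unset Printing Implicit Defensive.

Import Order.TTheory GRing.Theory Num.Theory.
Import numFieldNormedType.Exports.

Local Open Scope classical_set_scope.
Local Open Scope complex_scope.
Local Open Scope ring_scope.

(* Let omega = exp(2 pi i / N) and
     f(z, w) = N^-1 sum_(a, b < N) omega^(- a b) z^a w^b.
   On C^N take the clock U1 = diag(omega^j), the rotated clock U2 = omega U1 and
   the cyclic shift V.  Then V^b e_0 = e_b, so f(U1, V) e_0 = sum_b e_b while
   f(U2, V) e_0 = 0, and the left-hand side is at least sqrt N.  On the other
   side U1 - U2 = (1 - omega) U1 has S_p norm O(N^(1/p - 1)).  Finally f_n is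
   f with its coefficients multiplied by m(a, b) = w(|(a, b)| / 2^n), hence
     |f_n(z, w)| <= sum_b N^-1 |sum_a m(a, b) (z omega^(-b))^a|.
   Each summand is at most 1, and, because w is Lipschitz, summation by parts
   bounds it by (2 + C N / 2^n) / (N |1 - z omega^(-b)|); as the points
   z omega^(-b) are equally spaced, the sum over b costs only a logarithm.
   Altogether the Besov norm of f is O(N log^2 N), and N^(1/p) log^2 N is
   negligible against sqrt N since p > 2. *)

(** * The Hilbert space of complex n-tuples *)

Lemma normc_ge_Im (R : rcfType) (z : R[i]) : `|complex.Im z|%:C <= `|z|.
Proof. by rewrite normc_def lecR -sqrtr_sqr ler_wsqrtr// lerDr sqr_ge0. Qed.

Lemma normc_le_ReIm (R : rcfType) (z : R[i]) :
  `|z| <= (`|complex.Re z| + `|complex.Im z|)%:C.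
Proof.
rewrite {1}[z]complexE; apply: (le_trans (ler_normD _ _)).
rewrite normrM !normc_def /= !expr0n /= !addr0 !sqrtr_sqr add0r expr1n sqrtr1.
by rewrite mul1r raddfD.
Qed.

(* An alias, because 'rV already carries the sup norm. *)
Definition ell2 (R : realType) (n : nat) := 'rV[R[i]]_n.

HB.instance Definition _ (R : realType) n := GRing.Lmodule.on (ell2 R n).
HB.instance Definition _ (R : realType) n := Vector.on (ell2 R n).

Section Ell2.
Context {R : realType} {n : nat}.
Implicit Types x y : ell2 R n.

Definition ell2_dot x y : R[i] := \sum_i x 0 i * (y 0 i)^*%R.

Lemma ell2_dot_bilinear :
  bilinear_for *%R ((@Num.conj R[i]) \; *%R) ell2_dot.
Proof.
split=> [y|x] a u v; rewrite /ell2_dot /= mulr_sumr -big_split /=;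
  apply: eq_bigr => i _; rewrite !mxE.
  by rewrite mulrDl mulrA.
by rewrite rmorphD rmorphM mulrDr mulrCA.
Qed.

HB.instance Definition _ := bilinear_isBilinear.Build R[i] (ell2 R n)
  (ell2 R n) R[i] *%R ((@Num.conj R[i]) \; *%R) ell2_dot ell2_dot_bilinear.

Lemma ell2_dot_herm x y : ell2_dot x y = (-1) ^+ false * (ell2_dot y x)^*%R.
Proof.
rewrite expr0 mul1r /ell2_dot rmorph_sum; apply: eq_bigr => i _.
by rewrite rmorphM /= conjCK mulrC.
Qed.

HB.instance Definition _ := isHermitianSesquilinear.Build R[i] (ell2 R n)
  false (@Num.conj R[i]) ell2_dot ell2_dot_herm.

Lemma ell2_dot_gt0 x : x != 0 -> 0 < ell2_dot x x.
Proof.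
move=> /rV0Pn[i xi]; rewrite /ell2_dot (bigD1 i)//= -normCK.
apply: ltr_pwDl; first by rewrite exprn_gt0// normr_gt0.
by apply: sumr_ge0 => j _; rewrite -normCK exprn_ge0.
Qed.

HB.instance Definition _ := isDotProduct.Build R[i] (ell2 R n)
  ell2_dot ell2_dot_gt0.

Let norm x := sqrtC (ell2_dot x x).

Let norm_triangle x y : norm (x + y) <= norm x + norm y.
Proof. by rewrite (triangle_lerif (ell2_dot : {dot _ for _})). Qed.

Let normZ (a : R[i]) x : norm (a *: x) = `|a| * norm x.
Proof.
rewrite /norm (dnormZ (ell2_dot : {dot _ for _})) sqrtCM ?nnegrE ?exprn_ge0//.
by rewrite sqrCK.
Qed.

Let norm0_eq0 x : norm x = 0 -> x = 0.
Proof.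
by move/eqP; rewrite (sqrt_dnorm_eq0 (ell2_dot : {dot _ for _})) => /eqP.
Qed.

HB.instance Definition _ := Lmodule_isNormed.Build R[i] (ell2 R n)
  norm_triangle normZ norm0_eq0.

Lemma ell2_norm_sqr x : `|x| ^+ 2 = ell2_dot x x.
Proof. exact: sqrtCK. Qed.

Lemma ell2_norm_sqrE x : `|x| ^+ 2 = \sum_i `|x 0 i| ^+ 2.
Proof.
by rewrite ell2_norm_sqr; apply: eq_bigr => i _; rewrite normCK.
Qed.

Lemma ell2_coord_le x i : `|x 0 i| <= `|x|.
Proof.
rewrite -ler_sqr ?nnegrE// ell2_norm_sqrE (bigD1 i)//= lerDl.
by apply: sumr_ge0 => j _; rewrite exprn_ge0.
Qed.

Lemma ell2_norm_le x : `|x| <= \sum_i `|x 0 i|.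
Proof.
rewrite {1}[x]row_sum_delta; apply: (le_trans (ler_norm_sum _ _ _)).
apply: ler_sum => i _; rewrite normrZ ler_piMr//.
rewrite -(@ler_pXn2r _ 2) ?nnegrE// expr1n ell2_norm_sqrE (bigD1 i)//= big1.
  by rewrite mxE !eqxx addr0 normr1 expr1n.
by move=> j ji; rewrite mxE eqxx (negbTE ji) normr0 expr0n.
Qed.

(** Real and imaginary parts of coordinates are 1-Lipschitz, so they send [F] to Cauchy filters on
    the real line. The limits, assembled into a vector, give the limit of [F] because the norm is at
    most the sum of the moduli of the coordinates. *)
Lemma ell2_complete (F : set_system (ell2 R n)) :
  ProperFilter F -> cauchy F -> cvg F.
Proof.
move=> FF /cauchyP Fc.
have part_cvg (g : ell2 R n -> R) :
  (forall x y, `|g x - g y|%:C <= `|x - y|) ->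
  exists l : R, g x @[x --> F] --> l.
  move=> gl; exists (lim (g x @[x --> F])).
  apply: cauchy_cvg; apply/cauchyP => e e0.
  have [|x Fx] := Fc e%:C; first by rewrite ltcR.
  exists (g x); rewrite /nbhs/=; apply: filterS Fx => y.
  rewrite -!ball_normE /ball_ /= => xy.
  by rewrite -ltcR; apply: le_lt_trans xy.
have cre (i : 'I_n) : exists l : R,
  (complex.Re ((x : ell2 R n) 0 i)) @[x --> F] --> l.
  apply: part_cvg => x y; rewrite -(raddfB (@complex.Re R : Rcomplex R -> R)).
  apply: (le_trans (normc_ge_Re _)); apply: le_trans (ell2_coord_le _ i).
  by rewrite !mxE.
have cim (i : 'I_n) : exists l : R,
  (complex.Im ((x : ell2 R n) 0 i)) @[x --> F] --> l.
  apply: part_cvg => x y; rewrite -(raddfB (@complex.Im R : Rcomplex R -> R)).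
  apply: (le_trans (normc_ge_Im _)); apply: le_trans (ell2_coord_le _ i).
  by rewrite !mxE.
have [a aP] := choice cre; have [b bP] := choice cim.
apply/cvg_ex; exists (\row_i (a i +i* b i)).
apply/cvgrPdist_le => e e0.
have eR : e = (complex.Re e)%:C by rewrite RRe_real// gtr0_real.
(* Each of the [n] coordinates costs at most [2 * d], in total at most [e]; dividing by [n.+1] also
   covers [n = 0]. *)
set d := complex.Re e / (2 * n.+1%:R).
have e'0 : 0 < complex.Re e by rewrite -ltcR -eR.
have d0 : 0 < d by rewrite divr_gt0// mulr_gt0.
have near_lim : \forall x \near F, forall i : 'I_n,
    `|a i - complex.Re ((x : ell2 R n) 0 i)| <= d /\
    `|b i - complex.Im ((x : ell2 R n) 0 i)| <= d.
  apply: filter_forall => i.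
  move: (aP i) (bP i) => /cvgrPdist_le /(_ _ d0) + /cvgrPdist_le /(_ _ d0).
  by apply: filterS2.
apply: filterS near_lim => x xP; apply: le_trans (ell2_norm_le _) _.
apply: (@le_trans _ _ (\sum_(i < n) (2 * d)%:C)); last first.
  rewrite sumr_const card_ord -raddfMn eR lecR -mulr_natr.
  have : d * (2 * n.+1%:R) = complex.Re e by rewrite divfK// mulf_neq0.
  by rewrite -natr1 => dE; lra.
apply: ler_sum => i _; rewrite !mxE.
apply: (le_trans (normc_le_ReIm _)).
have [+ +] := xP i; rewrite lecR (_ : 2 * d = d + d); last by ring.
by case: (x 0 i) => u v /= ha hb; apply: lerD.
Qed.

HB.instance Definition _ := Uniform_isComplete.Build (ell2 R n) ell2_complete.

Definition ell2_hilbert : hilbertSpace R :=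
  @HilbertSpace R (ell2 R n) ell2_dot ell2_norm_sqr.

End Ell2.
Arguments ell2_hilbert : clear implicits.

(** * Singular numbers and Schatten norms *)

Lemma nneseries_finite (R : realType) (u : nat -> \bar R) (n : nat) :
  (forall k, 0 <= u k)%E -> (forall k, (n <= k)%N -> u k = 0%E) ->
  (\sum_(0 <= k <oo) u k = \sum_(0 <= k < n) u k)%E.
Proof.
move=> u0 un; rewrite (@nneseries_split _ _ 0 n)// add0n eseries0 ?adde0//.
by move=> k nk _; exact: un.
Qed.

Section Schatten.
Context {R : realType} {H : hilbertSpace R}.
Implicit Types T : H -> H.

Lemma opnorm_ge T (x : H) (b : R) :
  `|x| <= 1 -> b%:C <= `|T x| -> (b%:E <= opnorm T)%E.
Proof.
move=> x1 bT; apply: (@le_trans _ _ (complex.Re `|T x|)%:E).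
  by rewrite lee_fin -lecR RRe_real ?ger0_real ?normr_ge0.
by apply: ereal_sup_ubound; exists x.
Qed.

Lemma opnorm_ge0 T : (0 <= opnorm T)%E.
Proof. by apply: (@opnorm_ge T 0); rewrite ?normr0 ?ler01 ?normr_ge0. Qed.

Lemma opnorm_le T (c : R) : 0 <= c -> (forall x, `|T x| <= c%:C * `|x|) ->
  (opnorm T <= c%:E)%E.
Proof.
move=> c0 Tc; apply: ge_ereal_sup => _ [x /= x1 <-].
rewrite lee_fin -lecR RRe_real ?ger0_real//.
by apply: (le_trans (Tc _)); rewrite ler_piMr// lecR.
Qed.

Lemma singular_number_ge0 T n : (0 <= singular_number T n)%E.
Proof. by apply: le_ereal_inf_tmp => _ [K _ <-]; exact: opnorm_ge0. Qed.

Lemma singular_number_le_opnorm T n : (singular_number T n <= opnorm T)%E.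
Proof.
apply: ereal_inf_lbound; exists (\0%R : {linear H -> H}).
  exists (fun=> 0) => x; exists (fun=> 0).
  by rewrite big1// => i _; rewrite scaler0.
by congr opnorm; apply/funext => x; rewrite subr0.
Qed.

(** A map of rank at most 0 is an empty sum, so only [K = 0] competes in the infimum. *)
Lemma singular_number0 T : singular_number T 0 = opnorm T.
Proof.
apply/eqP; rewrite eq_le singular_number_le_opnorm /=.
apply: le_ereal_inf_tmp => _ [K [v Kv] <-].
suff -> : (fun x => T x - K x) = T by [].
by apply/funext => x; have [c ->] := Kv x; rewrite big_ord0 subr0.
Qed.

Lemma singular_number_rank_le n (T : {linear H -> H}) :
  rank_le n T -> singular_number T n = 0%E.
Proof.
move=> rT; apply/eqP; rewrite eq_le singular_number_ge0 andbT.
apply: (@le_trans _ _ (opnorm (fun x => T x - T x))).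
  by apply: ereal_inf_lbound; exists T.
by apply: opnorm_le => // x; rewrite subrr normr0 mul0r.
Qed.

Lemma rank_leS n T : rank_le n T -> forall k, (n <= k)%N -> rank_le k T.
Proof.
move=> [v Tv] k nk; exists (fun i => oapp v 0 (insub (i : nat))) => x.
have [c ->] := Tv x; exists (fun i => oapp c 0 (insub (i : nat))).
pose F i := oapp c 0 (insub i) *: oapp v 0 (insub i).
transitivity (\sum_(i < n) F i).
  by apply: eq_bigr => i _; rewrite /F valK.
rewrite (big_ord_widen _ F nk) big_mkcond; apply: eq_bigr => i _ /=.
by case: ltnP => // ni; rewrite /F insubN ?scaler0// -leqNgt.
Qed.

(** The operator norm is the singular number of index 0, whose power is one term of the nonnegative
    series. For [p = +oo] the two norms coincide by definition. *)
Lemma schatten_norm_ge_opnorm p T : (0 < p)%E -> (opnorm T <= schatten_norm p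
  T)%E.
Proof.
case: p => [r||] //=; rewrite lte_fin => r0.
set s := singular_number T.
have s0 k : (0 <= s k)%E by exact: singular_number_ge0.
rewrite -singular_number0 -[leLHS](@poweRe1 _ (s 0%N))//.
rewrite -(@mulfV _ r) ?gt_eqF// poweRrM.
apply: gt0_ler_poweR.
- by rewrite invr_ge0 ltW.
- by rewrite in_itv /= leey poweR_ge0.
- by rewrite in_itv /= leey nneseries_ge0// => *; exact: poweR_ge0.
- have -> : (s 0%N `^ r = \sum_(0 <= k < 1) s k `^ r)%E by rewrite big_nat1.
  by apply: nneseries_lim_ge => k _ _; exact: poweR_ge0.
Qed.

(** At most [n] singular numbers are nonzero and each is at most [c], so the norm is at most $(n
    c^r)^{1/r}$. *)
Lemma schatten_norm_le_rank (r c : R) n (T : {linear H -> H}) :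
  0 < r -> 0 <= c -> (forall x, `|T x| <= c%:C * `|x|) -> rank_le n T ->
  (schatten_norm r%:E T <= (n%:R `^ r^-1 * c)%:E)%E.
Proof.
move=> r0 c0 Tc Tn; rewrite /=; set s := singular_number T.
have s0 k : (0 <= s k)%E by exact: singular_number_ge0.
have sc k : (s k <= c%:E)%E.
  by apply: (le_trans (singular_number_le_opnorm _ _)); exact: opnorm_le.
rewrite (@nneseries_finite _ _ n) => [|k|k nk]; last 2 first.
  exact: poweR_ge0.
  by rewrite /s (singular_number_rank_le (rank_leS Tn nk)) poweR0r ?gt_eqF.
apply: (@le_trans _ _ (((n%:R * c `^ r)%:E `^ r^-1)%E)).
  apply: gt0_ler_poweR.
  - by rewrite invr_ge0 ltW.
  - by rewrite in_itv /= leey sume_ge0// => *; exact: poweR_ge0.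
  - by rewrite in_itv /= leey lee_fin mulr_ge0 ?powR_ge0.
  - apply: (@le_trans _ _ (\sum_(0 <= k < n) (c `^ r)%:E)%E).
      apply: lee_sum => k _; rewrite -poweR_EFin.
      apply: (gt0_ler_poweR (ltW r0)) => //; rewrite in_itv /= leey ?s0//.
      by rewrite lee_fin c0.
    by rewrite sumEFin sumr_const_nat subn0 mulr_natl.
by rewrite lee_fin powRM ?powR_ge0// -powRrM mulfV ?gt_eqF// powRr1.
Qed.

End Schatten.

(** * Points of the unit circle *)

Section Circle.
Context {R : realType}.
Implicit Types (s t : R).

Lemma circleD s t : circle (s + t) = circle s * circle t.
Proof.
rewrite /circle !mulrDr cosD sinD; apply/eqP; rewrite eq_complex /= eqxx /=.
by rewrite addrC.
Qed.

Lemma circle0 : circle 0 = 1 :> R[i].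
Proof. by rewrite /circle mulr0 cos0 sin0. Qed.

Lemma norm_circle t : `|circle t| = 1.
Proof. by rewrite normc_def /= cos2Dsin2 sqrtr1. Qed.

Lemma circle_neq0 t : circle t != 0.
Proof. by rewrite -normr_gt0 norm_circle. Qed.

Lemma circleN t : circle (- t) = (circle t)^-1.
Proof.
apply: (mulfI (circle_neq0 t)); rewrite mulfV ?circle_neq0//.
by rewrite -circleD subrr circle0.
Qed.

Lemma circleX t n : circle t ^+ n = circle (n%:R * t).
Proof.
elim: n => [|n IH]; first by rewrite expr0 mul0r circle0.
by rewrite exprS IH -circleD -nat1r mulrDl mul1r.
Qed.

Lemma circle_exprz t (j : int) : circle t ^ j = circle (j%:~R * t).
Proof.
case: j => n; first by rewrite -exprnP circleX.
by rewrite NegzE -exprnN circleX -circleN rmorphN mulNr.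
Qed.

Lemma circle_nat n : circle n%:R = 1 :> R[i].
Proof.
rewrite -[n%:R]mulr1 -circleX /circle mulr1 mulr_natl cos2pi sin2pi.
by rewrite [X in X ^+ _](_ : _ = 1)// expr1n.
Qed.

Lemma circle_int (j : int) : circle j%:~R = 1 :> R[i].
Proof. by rewrite -[j%:~R]mulr1 -circle_exprz (circle_nat 1) exp1rz. Qed.

Lemma norm_1Bcircle t : `|1 - circle t| = (2 * `|sin (pi * t)|)%:C.
Proof.
rewrite normc_def /circle; congr (_%:C).
have -> : 2 * pi * t = (pi * t) *+ 2 by rewrite mulr2n; ring.
rewrite /= cos_mulr2n sin_mulr2n sub0r sqrrN.
have := cos2sin2 (pi * t); set c := cos _; set s := sin _ => c2.
have -> : (1 - (c ^+ 2 *+ 2 - 1)) ^+ 2 + ((c * s) *+ 2) ^+ 2 =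
    (2 - 2 * c ^+ 2) ^+ 2 + 4 * c ^+ 2 * s ^+ 2 by ring.
have -> : (2 - 2 * c ^+ 2) ^+ 2 + 4 * c ^+ 2 * s ^+ 2 = (2 * s) ^+ 2.
  by rewrite c2; ring.
by rewrite sqrtr_sqr normrM ger0_norm.
Qed.

(** Common source of both estimates of the sine: the upper one from $|\cos|\le 1$, the lower one
    from a lower bound of $\cos$ near 0. *)
Lemma sin_MVT (y : R) : 0 <= y -> exists2 c, 0 <= c <= y & sin y = cos c * y.
Proof.
move=> y0.
have [|c] := @MVT_segment R sin cos 0 y y0 (fun x _ => is_derive_sin x).
  exact/continuous_subspaceT/continuous_sin.
by rewrite in_itv /= sin0 !subr0 => cy E; exists c.
Qed.

Lemma norm_sin_le (y : R) : `|sin y| <= `|y|.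
Proof.
wlog y0 : y / 0 <= y => [H|].
  have [/H//|y0] := leP 0 y.
  by have := H (- y); rewrite sinN !normrN oppr_ge0; apply; exact: ltW.
by have [c _ ->] := sin_MVT y0; rewrite normrM ler_piMl// cos_max.
Qed.

(* With sin y = 2 sin (y/2) cos (y/2) and sin (y/2) = (y/2) cos c for some
   c <= y/2, this follows from cos >= cos (pi/4) = 1/sqrt 2 on [0, pi/4]. *)
Lemma sin_ge_half (y : R) : 0 <= y <= pi / 2 -> y / 2 <= sin y.
Proof.
move=> /andP[y0 ypi]; have pi2 := @pi_ge2 R.
have [|c /andP[c0 cy] sy] := @sin_MVT (y / 2); first by rewrite divr_ge0.
have cosge (u : R) : 0 <= u <= pi / 4 -> 2^-1 <= cos u ^+ 2.
  move=> /andP[u0 upi].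
  have : 0 <= cos (u *+ 2).
    by apply: cos_ge0_pihalf; apply/andP; split; lra.
  by rewrite cos_mulr2n; lra.
have cos0 (u : R) : 0 <= u <= pi / 4 -> 0 <= cos u.
  by move=> /andP[? ?]; apply: cos_ge0_pihalf; apply/andP; split; lra.
have c4 : 0 <= c <= pi / 4 by apply/andP; split; lra.
have y4 : 0 <= y / 2 <= pi / 4 by apply/andP; split; lra.
have half : 2^-1 <= cos c * cos (y / 2).
  rewrite -ler_sqr ?nnegrE ?mulr_ge0 ?cos0//.
  by rewrite exprMn [leLHS]expr2; apply: ler_pM; rewrite ?cosge.
have -> : sin y = 2 * (y * 2^-1 * (cos c * cos (y / 2))).
  rewrite {1}(_ : y = (y / 2) *+ 2); last by lra.
  by rewrite sin_mulr2n sy; ring.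
by nra.
Qed.

(** The chord is $2|\sin \pi t|\le 2\pi|t|$, and 8 bounds $2\pi$. *)
Lemma norm_1Bcircle_le t : `|1 - circle t| <= (8 * `|t|)%:C.
Proof.
rewrite norm_1Bcircle lecR;
  apply: (le_trans (ler_wpM2l _ (norm_sin_le _))) => //.
rewrite normrM ger0_norm ?pi_ge0// mulrA ler_wpM2r//.
by have := @pihalf_lt2 R; lra.
Qed.

(** The minimum is the distance from [t] to the integers. The symmetries $t\mapsto -t$ and $t\mapsto
    1-t$ reduce to $0\le t\le 1/2$, where $\sin \pi t\ge \pi t/2\ge t$. *)
Lemma norm_1Bcircle_ge t : `|t| <= 1 ->
  (2 * Num.min `|t| (1 - `|t|))%:C <= `|1 - circle t|.
Proof.
rewrite norm_1Bcircle lecR ler_pM2l// => t1.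
wlog t0 : t t1 / 0 <= t => [H|].
  have [/H->//|t0] := leP 0 t.
  by have := H (- t); rewrite normrN mulrN sinN normrN oppr_ge0; apply => //;
    exact: ltW.
rewrite (ger0_norm t0) in t1 *.
have half (u : R) : 0 <= u <= 2^-1 -> u <= `|sin (pi * u)|.
  move=> /andP[u0 u2]; apply: le_trans (ler_norm _).
  have pi2 := @pi_ge2 R.
  have piu : 0 <= pi * u <= pi / 2 by apply/andP; split; nra.
  by apply: le_trans (sin_ge_half piu); nra.
have [t2|t2] := leP t 2^-1.
  by apply: le_trans (half t _); rewrite ?ge_min ?lexx// t0.
apply: (@le_trans _ _ (1 - t)); first by rewrite ge_min lexx orbT.
have -> : sin (pi * t) = sin (pi * (1 - t)).
  by rewrite mulrBr mulr1 sinB sinpi cospi mul0r sub0r mulN1r opprK.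
by apply: half; lra.
Qed.

(** Geometric sum with ratio $\omega=e^{2\pi i/n}$: multiplied by $1-\omega$ it becomes
    $1-\omega^n=0$, and $\omega\ne 1$ by the lower bound on chords. *)
Lemma sum_circle n : (1 < n)%N -> \sum_(a < n) circle (a%:R / n%:R) = 0 :> R[i].
Proof.
move=> n1; have n0 : n%:R != 0 :> R by rewrite pnatr_eq0 -lt0n ltnW.
have w1 : 1 - circle (n%:R^-1 : R) != 0.
  rewrite -normr_gt0; apply: lt_le_trans (norm_1Bcircle_ge _).
    rewrite ltcR mulr_gt0// lt_min normr_gt0 invr_eq0 n0 /= subr_gt0.
    by rewrite ger0_norm ?invr_ge0// invf_lt1 ?ltr1n// ltr0n ltnW.
  by rewrite ger0_norm ?invr_ge0// invf_le1 ?ler1n ?ltr0n ltnW.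
apply: (mulfI w1); rewrite mulr0.
under eq_bigr do rewrite -circleX.
by rewrite -[X in X * _]opprB mulNr -subrX1 circleX mulfV//
  (circle_nat 1) subrr oppr0.
Qed.

End Circle.

(** * Trigonometric polynomials on the torus *)

Section TorusIntegral.
Context {R : realType}.
Implicit Types (a b : int) (c : R).
Local Notation mu := (@torus_measure R).
Local Notation P := (uniform_prob (@ltr01 R)).

Lemma torus_measure_setT : mu [set: _] = 1%E.
Proof.
have -> : mu [set: _] = (P setT * P setT)%E.
  by rewrite -setXTT; exact: product_measure1E.
by rewrite !probability_setT mule1.
Qed.

Lemma measurable_cos : measurable_fun [set: R] (@cos R).
Proof.
by apply: continuous_measurable_fun; exact: continuous_cos.
Qed.

Lemma measurable_cos_affine a b c :
  measurable_fun [set: R * R]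
    (fun t : R * R => cos (2 * pi * (a%:~R * t.1 + b%:~R * t.2) + c)).
Proof.
apply: measurableT_comp; first exact: measurable_cos.
apply: measurable_funD => //; apply: measurable_funM => //.
by apply: measurable_funD; apply: measurable_funM.
Qed.

(** Adding 1 makes the integrand nonnegative, so that integration against the uniform law, and
    Tonelli afterwards, apply directly. The phase [c] absorbs the other variable and turns cosines
    into sines. *)
Lemma integral_uniform_1Dcos b c : b != 0 ->
  (\int[P]_t (1 + cos (2 * pi * (b%:~R * t) + c))%:E = 1)%E.
Proof.
move=> b0; rewrite integral_uniform; last 2 first.
- apply/measurable_EFinP; apply: measurable_funD => //.
  apply: measurableT_comp; first exact: measurable_cos.
  by apply: measurable_funD => //; apply: measurable_funM => //;
    apply: measurable_funM.
- by move=> t; rewrite lee_fin; have := cos_geN1 (2 * pi * (b%:~R * t) + c);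
    lra.
rewrite subr0 invr1 mul1e.
pose k : R := 2 * pi * b%:~R.
have k0 : k != 0 by rewrite !mulf_neq0 ?intr_eq0// gt_eqF// pi_gt0.
pose F (t : R) := t + k^-1 * sin (k * t + c).
have dF (t : R) : is_derive t (1 : R) F (1 + cos (2 * pi * (b%:~R * t) + c)).
  rewrite /F; apply: is_derive_eq.
  rewrite addr0 /GRing.scale /= mulr1 mulrCA mulVf// mulr1 /k.
  by congr (1 + cos (_ + _)); ring.
have cF : continuous F.
  by move=> t; apply: differentiable_continuous; apply/derivable1_diffP;
    exact: ex_derive.
rewrite (@continuous_FTC2 _ _ F)//.
(* The components of [circle b = 1] give the values of cosine and sine at $2\pi b$. *)
- have circ1 := @circle_int R b.
  rewrite -EFinB /F mulr1 mulr0 !add0r sinD.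
  by case: circ1 => -> ->; congr (_%:E); ring.
- apply: continuous_subspaceT => t.
  apply: cvgD; first exact: cvg_cst.
  apply: (@continuous_comp _ _ _ (fun x : R => 2 * pi * (b%:~R * x) + c) cos).
    apply: cvgD; last exact: cvg_cst.
    by apply: cvgMr; apply: cvgMr; exact: cvg_id.
  exact: continuous_cos.
- by split => //; [apply: cvg_at_right_filter | apply: cvg_at_left_filter];
    exact: cF.
- move=> t _.
  by rewrite derive1E derive_val.
Qed.

(** If $b\ne 0$, the inner integral is already 1, the first variable being part of the phase; if
    $b=0$, the integrand depends on the first variable alone and $a\ne 0$. *)
Lemma torus_integral_1Dcos a b c : (a, b) != 0 ->
  (\int[mu]_t (1 + cos (2 * pi * (a%:~R * t.1 + b%:~R * t.2) + c))%:E = 1)%E.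
Proof.
move=> ab0; rewrite fubini_tonelli1/=; last 2 first.
- by apply/measurable_EFinP; apply: measurable_funD => //;
    exact: measurable_cos_affine.
- by move=> t; rewrite lee_fin;
    have := cos_geN1 (2 * pi * (a%:~R * t.1 + b%:~R * t.2) + c); lra.
rewrite /fubini_F/=.
have [b0|b0] := eqVneq b 0.
  have a0 : a != 0 by apply: contra_neq ab0 => ->; rewrite b0.
  rewrite -[RHS](integral_uniform_1Dcos c a0); apply: eq_integral => s _.
  transitivity (\int[P]_x (cst (1 + cos (2 * pi * (a%:~R * s) + c))%:E x))%E.
    by apply: eq_integral => t _; rewrite /= b0 mulr0z mul0r addr0.
  by rewrite integral_cst//= probability_setT mule1.
transitivity (\int[P]_x (cst 1%E x))%E.
  apply: eq_integral => s _;
    rewrite -[RHS](integral_uniform_1Dcos (2 * pi * (a%:~R * s) + c) b0).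
  by apply: eq_integral => t _; congr (_ + cos _)%:E; ring.
by rewrite integral_cst//= probability_setT mule1.
Qed.

Lemma bounded_cos_affine a b c :
  [bounded cos (2 * pi * (a%:~R * t.1 + b%:~R * t.2) + c) : R | t in [set: R *
    R]].
Proof.
exists 1; split => // x x1 t _ /=; apply: le_trans (cos_max _) _; exact: ltW.
Qed.

Lemma integrable_cos_affine a b c : mu.-integrable [set: R * R]
  (EFin \o (fun t : R * R => cos (2 * pi * (a%:~R * t.1 + b%:~R * t.2) + c))).
Proof.
apply: measurable_bounded_integrable => //.
- by rewrite [ltLHS]torus_measure_setT ltry.
- exact: measurable_cos_affine.
- exact: bounded_cos_affine.
Qed.

Lemma torus_integral_cos a b c :
  \int[mu]_t cos (2 * pi * (a%:~R * t.1 + b%:~R * t.2) + c) =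
  if (a, b) == 0 then cos c else 0.
Proof.
case: eqVneq => [[-> ->]|ab0].
  transitivity (\int[mu]_x (cst (cos c) x)).
    by apply: eq_Rintegral => t _; rewrite /= !mulr0z !mul0r addr0 mulr0 add0r.
  by rewrite Rintegral_cst//= [X in fine X]torus_measure_setT mulr1.
(* Adding 1 to both sides brings back the nonnegative integrand. *)
apply: (addrI 1); rewrite addr0.
transitivity (\int[mu]_t (1 + cos (2 * pi * (a%:~R * t.1 + b%:~R * t.2) + c))).
  rewrite RintegralD//; last 2 first.
  - apply: (@measurable_bounded_integrable _ _ _ mu (cst 1)) => //.
    + by rewrite [ltLHS]torus_measure_setT ltry.
    + exact: bounded_cst.
  - exact: integrable_cos_affine.
  by rewrite Rintegral_cst//= [X in fine X]torus_measure_setT mulr1.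
by rewrite /Rintegral torus_integral_1Dcos.
Qed.

(** Real and imaginary parts are combinations of cosines with phases 0 and $-\pi/2$. Integrability
    is recorded because additivity of the integral requires it. *)
Lemma torus_integral_circle (z : R[i]) a b (g : R[i] -> R[i] -> R[i]) :
  (forall s t, g (circle s) (circle t) =
     z * circle (a%:~R * s + b%:~R * t)) ->
  [/\ mu.-integrable [set: R * R]
        (fun t => (complex.Re (g (circle t.1) (circle t.2)))%:E),
      mu.-integrable [set: R * R]
        (fun t => (complex.Im (g (circle t.1) (circle t.2)))%:E) &
      torus_integral g = if (a, b) == 0 then z else 0].
Proof.
case: z => x y gE.
have intC := integrable_cos_affine a b 0.
have intS := integrable_cos_affine a b (- (pi / 2)).
set C := fun t : R * R => _ in intC; set S := fun t : R * R => _ in intS.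
have ReE t : complex.Re (g (circle t.1) (circle t.2)) = x * C t - y * S t.
  by rewrite gE /C /S cosBpihalf addr0.
have ImE t : complex.Im (g (circle t.1) (circle t.2)) = x * S t + y * C t.
  by rewrite gE /C /S cosBpihalf addr0.
have intZ k (h : R * R -> R) : mu.-integrable [set: R * R] (EFin \o h) ->
    mu.-integrable [set: R * R] (EFin \o (fun t => k * h t)).
  move=> ih; rewrite (_ : _ \o _ = fun t => (k%:E * (EFin \o h) t)%E) //.
  exact: integrableZl.
split.
- rewrite (_ : (fun _ => _) = EFin \o (fun t => x * C t - y * S t)); last first.
    by apply/funext => t; rewrite ReE.
  exact: (integrableB measurableT (intZ x _ intC) (intZ y _ intS)).
- rewrite (_ : (fun _ => _) = EFin \o (fun t => x * S t + y * C t)); last first.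
    by apply/funext => t; rewrite ImE.
  exact: (integrableD measurableT (intZ x _ intS) (intZ y _ intC)).
transitivity ((\int[mu]_t (x * C t - y * S t)) +i* (\int[mu]_t (x * S t + y * C
  t))).
  by congr (_ +i* _); apply: eq_Rintegral => t _; rewrite ?ReE ?ImE.
rewrite RintegralB ?RintegralD//; try exact: intZ.
rewrite !RintegralZl// !torus_integral_cos cosN cos_pihalf cos0.
by case: ifP => _; rewrite !mulr0 ?mulr1 ?subr0 ?add0r.
Qed.

Lemma eq_torus_integral (g h : R[i] -> R[i] -> R[i]) :
  (forall s t, g (circle s) (circle t) = h (circle s) (circle t)) ->
  torus_integral g = torus_integral h.
Proof.
move=> gh; rewrite /torus_integral; congr (_ +i* _); apply: eq_Rintegral => t _;
  by rewrite gh.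
Qed.

Lemma torus_integral_sum (I : Type) (r : seq I) (z : I -> R[i])
    (k : I -> int * int) (g : R[i] -> R[i] -> R[i]) :
  (forall s t, g (circle s) (circle t) = \sum_(i <- r)
     z i * circle ((k i).1%:~R * s + (k i).2%:~R * t)) ->
  torus_integral g = \sum_(i <- r | k i == 0) z i.
Proof.
pose G i u1 u2 : R[i] := z i * monomZ2 (k i) u1 u2.
have GE i s t : G i (circle s) (circle t) =
    z i * circle ((k i).1%:~R * s + (k i).2%:~R * t).
  by rewrite /G /monomZ2 !circle_exprz circleD.
pose S r u1 u2 : R[i] := \sum_(i <- r) G i u1 u2.
move=> gE; rewrite (@eq_torus_integral _ (S r)); last first.
  by move=> s t; rewrite gE; apply: eq_bigr => i _; rewrite GE.
(* The induction on [r] has to carry integrability along with the value. *)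
suff [] : [/\ mu.-integrable [set: R * R]
        (fun t => (complex.Re (S r (circle t.1) (circle t.2)))%:E),
      mu.-integrable [set: R * R]
        (fun t => (complex.Im (S r (circle t.1) (circle t.2)))%:E) &
      torus_integral (S r) = \sum_(i <- r | k i == 0) z i] by [].
elim: r {gE} => [|i r [iRe iIm IH]].
  have -> : S [::] = fun _ _ => 0 by apply/funext => u1; apply/funext => u2;
    rewrite /S big_nil.
  rewrite big_nil.
  have [|h1 h2 h3] := @torus_integral_circle 0 0 0 (fun _ _ => 0).
    by move=> s t; rewrite mul0r.
  by split; [exact: h1 | exact: h2 | rewrite h3 (_ : (_ == _) = true)].
have -> : S (i :: r) = fun u1 u2 => G i u1 u2 + S r u1 u2.
  by apply/funext => u1; apply/funext => u2; rewrite /S big_cons.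
have ReD x y : complex.Re (x + y : R[i]) = complex.Re x + complex.Re y.
  exact: (raddfD (@complex.Re R : Rcomplex R -> R)).
have ImD x y : complex.Im (x + y : R[i]) = complex.Im x + complex.Im y.
  exact: (raddfD (@complex.Im R : Rcomplex R -> R)).
have [iRe1 iIm1 E1] := @torus_integral_circle (z i) (k i).1 (k i).2 (G i) (GE
  i).
split.
- under eq_fun do rewrite ReD EFinD.
  exact: (integrableD measurableT iRe1 iRe).
- under eq_fun do rewrite ImD EFinD.
  exact: (integrableD measurableT iIm1 iIm).
rewrite big_cons -IH; transitivity (torus_integral (G i) + torus_integral (S
  r)).
  transitivity
      ((\int[mu]_t (complex.Re (G i (circle t.1) (circle t.2)) +
                    complex.Re (S r (circle t.1) (circle t.2)))) +i*
       (\int[mu]_t (complex.Im (G i (circle t.1) (circle t.2)) +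
                    complex.Im (S r (circle t.1) (circle t.2))))).
    by congr (_ +i* _); apply: eq_Rintegral => t _; rewrite ?ReD ?ImD.
  by rewrite !RintegralD.
rewrite E1 -surjective_pairing.
by case: ifP => // _; rewrite add0r.
Qed.

End TorusIntegral.

(** * Littlewood-Paley multipliers *)

Section BesovMultiplier.
Context {R : realType}.
Implicit Types (w : R -> R) (j : int * int).

Lemma besov_window_eq0 w x : besov_window w -> x < 2^-1 \/ 2 < x -> w x = 0.
Proof.
move=> [_ _ w_supp _] x_out; apply: contrapT => /eqP wx.
have : `[2^-1, 2]%classic x by apply: w_supp; exact: subset_closure.
by rewrite /= in_itv /= => /andP[]; case: x_out; lra.
Qed.

(** On $[1,2]$ the identity $w(s)=1-w(s/2)$ gives the bound; on $[1/2,1)$ the same identity is read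
    at $s=2x$. *)
Lemma besov_window_le1 w x : besov_window w -> w x <= 1.
Proof.
move=> hw; have [_ w0 _ wE] := hw.
have [x1|x1] := ltP x 2^-1; first by rewrite besov_window_eq0//; left.
have [x2|x2] := ltP 2 x; first by rewrite besov_window_eq0//; right.
have [x3|x3] := leP 1 x.
  by rewrite wE; [have := w0 (x / 2); lra | apply/andP].
have : w (2 * x) = 1 - w x.
  rewrite wE; last by apply/andP; split; lra.
  by rewrite mulrAC mulfV// mul1r.
by have := w0 (2 * x); lra.
Qed.

(** The Fourier coefficients of $W_n$, that is, the symbol of the multiplier $f\mapsto f_n$. *)
Definition besov_mult w n j : R :=
  if n is 0%N then
    if absZ2 j <= 1 :> R then 1 else if absZ2 j < 2 :> R then w (absZ2 j) else 0
  else w (absZ2 j / 2 ^+ n).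

(** The lattice points of $[-K,K]^2$, listed so that the sums over $\mathbb{Z}^2$ become finite sums
    over a sequence. *)
Definition int_box (K : nat) : seq (int * int) :=
  let I := [seq i%:Z - K%:Z | i <- iota 0 (K + K).+1] in
  [seq (x, y) | x <- I, y <- I].

Lemma int_box_uniq K : uniq (int_box K).
Proof.
have I_uniq : uniq [seq i%:Z - K%:Z | i <- iota 0 (K + K).+1].
  by rewrite map_inj_uniq ?iota_uniq// => a b /addIr[].
by apply: allpairs_uniq => // -[? ?] [? ?] _ _.
Qed.

Lemma absZ2_ge1 j : (`|j.1|%N%:R <= absZ2 j :> R).
Proof.
by rewrite /absZ2 natr_absz intr_norm -sqrtr_sqr ler_wsqrtr// lerDl sqr_ge0.
Qed.

Lemma absZ2_ge2 j : (`|j.2|%N%:R <= absZ2 j :> R).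
Proof.
by rewrite /absZ2 natr_absz intr_norm -sqrtr_sqr ler_wsqrtr// lerDr sqr_ge0.
Qed.

Lemma mem_int_box K j : (`|j.1| <= K)%N -> (`|j.2| <= K)%N -> j \in int_box K.
Proof.
case: j => a b aK bK; apply/allpairsP; exists (a, b) => /=.
have mem_I (x : int) : (`|x| <= K)%N -> x \in [seq i%:Z - K%:Z | i <- iota 0 (K
  + K).+1].
  move=> xK; apply/mapP; exists (absz (x + K%:Z)); last first.
    by rewrite gez0_abs; lia.
  by rewrite mem_iota; lia.
by split => //; exact: mem_I.
Qed.

Lemma absZ2_mem_int_box K j : (absZ2 j <= K%:R :> R) -> j \in int_box K.
Proof.
move=> jK; apply: mem_int_box; rewrite -(ler_nat R); apply: le_trans jK.
  exact: absZ2_ge1.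
exact: absZ2_ge2.
Qed.

(** All frequencies of $W_n$ satisfy $|j|\le 2^{n+1}$, hence lie in the box; both cases of the
    kernel become one finite sum. *)
Lemma besov_kernelE w n K (z1 z2 : R[i]) : besov_window w ->
  (2 ^ n.+1 <= K)%N ->
  besov_kernel w n z1 z2 =
  \sum_(j <- int_box K) (besov_mult w n j)%:C * monomZ2 j z1 z2.
Proof.
move=> hw nK.
have widen (F : int * int -> R[i]) : (forall j,
  K%:R < absZ2 j :> R -> F j = 0) ->
    \sum_(j \in [set: int * int]) F j = \sum_(j <- int_box K) F j.
  move=> F0; rewrite -(fsbig_widen [set` int_box K] setT)//; last first.
    move=> j [_ /= /negP jK]; apply: F0; rewrite ltNge; apply: contra jK.
    exact: absZ2_mem_int_box.
  by rewrite -fsbig_seq// int_box_uniq.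
case: n nK => [|n] nK /=; last first.
  apply: widen => j jK; rewrite (besov_window_eq0 hw) ?mul0r//; right.
  rewrite ltr_pdivlMr ?exprn_gt0// -exprS; apply: le_lt_trans jK.
  by rewrite -natrX ler_nat.
rewrite [in LHS]fsbig_mkcond [X in _ + X]fsbig_mkcond !widen.
- rewrite -big_split /=; apply: eq_bigr => j _; rewrite /patch.
  have -> : (j \in [set j | absZ2 j <= 1 :> R]) = (absZ2 j <= 1 :> R).
    by apply/idP/idP; rewrite inE.
  have -> : (j \in [set j | 1 < (absZ2 j : R) < 2]) = (1 < (absZ2 j : R) < 2).
    by apply/idP/idP; rewrite inE.
  case: leP => //= _; first by rewrite mul1r addr0.
  by case: ifP => _; rewrite add0r// mul0r.
- move=> j jK; rewrite /patch ifF//; apply/negbTE; rewrite notin_setE /=.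
  by apply/negP; rewrite negb_and -!leNgt (le_trans _ (ltW jK)) ?orbT// ler_nat.
- move=> j jK; rewrite /patch ifF//; apply/negbTE; rewrite notin_setE /=.
  by apply/negP; rewrite -ltNge (lt_trans _ jK)// ltr1n.
Qed.
End BesovMultiplier.

(** * Convolution as multiplication of Fourier coefficients *)

Section BesovConvolution.
Context {R : realType}.
Implicit Types (w : R -> R) (c : nat -> nat -> R[i]).

Definition poly2 N c : {poly {poly R[i]}} :=
  \poly_(a < N) \poly_(b < N) c a b.

Lemma horner_poly2 N c z1 z2 :
  (poly2 N c).[z1, z2] = \sum_(a < N) \sum_(b < N) c a b * (z1 ^+ a * z2 ^+ b).
Proof.
rewrite /poly2 horner_poly horner_sum; apply: eq_bigr => a _.
rewrite hornerM -polyC_exp hornerC horner_poly mulr_suml.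
by apply: eq_bigr => b _; ring.
Qed.

Lemma besov_conv w n N c (x y : R) : besov_window w ->
  torus_conv (fun z1 z2 => (poly2 N c).[z1, z2]) (besov_kernel w n)
    (circle x) (circle y) =
  \sum_(a < N) \sum_(b < N) (besov_mult w n (a%:Z, b%:Z))%:C * c a b *
    circle (a%:R * x + b%:R * y).
Proof.
(* The box must contain the frequencies of the kernel and those of the polynomial. *)
move=> hw; rewrite /torus_conv; pose K := (2 ^ n.+1 + N)%N.
pose m j : R[i] := (besov_mult w n j)%:C.
pose z (i : ('I_N * 'I_N) * (int * int)) :=
  c i.1.1 i.1.2 * m i.2 * circle (i.2.1%:~R * x + i.2.2%:~R * y).
pose k (i : ('I_N * 'I_N) * (int * int)) : int * int :=
  (i.1.1%:Z - i.2.1, i.1.2%:Z - i.2.2).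
pose r := [seq (q, j) | q <- index_enum ('I_N * 'I_N)%type, j <- int_box K].
rewrite (@torus_integral_sum R _ r z k) => [|s t].
  rewrite big_mkcond big_allpairs_dep pair_big /=;
    apply: eq_bigr => -[a b] _ /=.
  have kE j : (k ((a, b), j) == 0) = (j == (a%:Z, b%:Z)).
    by case: j => j1 j2; rewrite /k /= -!pair_eqE /= /pair_eq /= !subr_eq0 ![_
      == j1]eq_sym ![_ == j2]eq_sym.
  rewrite (bigD1_seq (a%:Z, b%:Z)) ?int_box_uniq//=; last first.
    by apply: mem_int_box => /=; rewrite /K; apply: leq_trans (leq_addl _ _);
      exact: ltnW.
  rewrite kE eqxx big1 ?addr0 => [|j jab].
    by rewrite /z /m /= [c _ _ * _]mulrC.
  by rewrite kE (negbTE jab).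
rewrite horner_poly2 (@besov_kernelE _ _ _ K)//; last by rewrite leq_addr.
rewrite [RHS]big_allpairs_dep /= [X in X * _]pair_big /= mulr_suml.
apply: eq_bigr => -[a b] _ /=.
rewrite mulr_sumr; apply: eq_bigr => j _.
rewrite /z /k /m /monomZ2 /= -!circleN -!circleD !circle_exprz !circleX
  -!circleD.
rewrite mulrACA -circleD -[RHS]mulrA -circleD.
by congr (_ * circle _); rewrite !rmorphB /=; ring.
Qed.
End BesovConvolution.

(** * Regularity and support of the multipliers *)

Section WindowLipschitz.
Context {R : realType}.
Implicit Types (w : R -> R) (j : int * int).

(** The constant is the maximum of $|w'|$ on $[0,3]$, by the mean value theorem. *)
Lemma besov_window_lipschitz w : besov_window w ->
  exists2 C : R, 0 <= C & forall x y, 0 <= x -> 0 <= y ->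
    `|w x - w y| <= C * `|x - y|.
Proof.
move=> hw; have [w_smooth _ _ _] := hw.
have dw x : is_derive x (1 : R) w (derive1 w x).
  by rewrite derive1E; apply: derivableP; exact: (w_smooth 0%N).
have cw' : continuous (derive1 w).
  move=> x; apply: differentiable_continuous; apply/derivable1_diffP.
  exact: (w_smooth 1%N).
have [||c _ wc] := @EVT_max R (fun x => `|derive1 w x|) 0 3.
- by [].
- by apply: continuous_subspaceT => x; apply: cvg_norm; exact: cw'.
have lip x y : 0 <= x <= y -> y <= 3 -> `|w x - w y| <= `|derive1 w c| * `|x -
  y|.
  move=> /andP[x0 xy] y3.
  have [|u] := @MVT_segment R w (derive1 w) x y xy (fun u _ => dw u).
    apply: continuous_subspaceT => u; apply: differentiable_continuous.
    apply/derivable1_diffP; exact: ex_derive.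
  rewrite in_itv /= => /andP[xu uy] wE.
  rewrite distrC wE normrM [`|y - x|]distrC ler_wpM2r// wc// in_itv /=.
  by rewrite (le_trans x0 xu) (le_trans uy y3).
exists `|derive1 w c| => // x y.
(* Since [w] vanishes beyond 2, arguments can be cut off at 3, and the cut-off does not increase
   distances. *)
have w3 x' : w x' = w (Num.min x' 3).
  by case: leP => // x3; rewrite !(besov_window_eq0 hw)//; right; lra.
wlog xy : x y / x <= y => [H x0 y0|x0 y0].
  have [xy|/ltW xy] := leP x y; first exact: H.
  by rewrite distrC [`|x - y|]distrC; exact: H.
have /andP[d0 dxy] : 0 <= Num.min y 3 - Num.min x 3 <= y - x.
  by case: (leP y 3) => y3; case: (leP x 3) => x3; apply/andP; split; lra.
rewrite (w3 x) (w3 y); apply: le_trans (lip _ _ _ _) _.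
- by rewrite -[X in _ && X]subr_ge0 d0 le_min x0 ler0n.
- by rewrite ge_min lexx orbT.
rewrite ler_wpM2l// distrC [`|x - y|]distrC !ger0_norm//.
exact: le_trans dxy.
Qed.

(** $|(a+1,b)|^2=|(a,b)|^2+2a+1\le(|(a,b)|+1)^2$. *)
Lemma absZ2_step (a b : nat) :
  `|absZ2 (a.+1%:Z, b%:Z) - absZ2 (a%:Z, b%:Z)| <= 1 :> R.
Proof.
rewrite /absZ2 /=; set u := _ ^+ 2 + _; set v := _ ^+ 2 + _.
have b0 : 0 <= (b%:R : R) ^+ 2 by exact: sqr_ge0.
have a0 : 0 <= (a%:R : R) by [].
have v0 : 0 <= v by rewrite addr_ge0 ?sqr_ge0.
have uv : u = v + 2 * a%:R + 1 by rewrite /u /v /= -!pmulrn -natr1; ring.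
rewrite ger0_norm ?subr_ge0 ?ler_wsqrtr// ?uv; last by lra.
rewrite lerBlDr -[leRHS]ger0_norm ?addr_ge0 ?sqrtr_ge0//
  -sqrtr_sqr ler_wsqrtr//.
rewrite sqrrD expr1n mul1r sqr_sqrtr//.
have : a%:R <= Num.sqrt v.
  by rewrite -[leLHS]ger0_norm// -sqrtr_sqr ler_wsqrtr// /v -!pmulrn lerDl.
by lra.
Qed.

Lemma besov_mult_bounds w n j : besov_window w -> 0 <= besov_mult w n j <= 1.
Proof.
move=> hw; have [_ w0 _ _] := hw; have w1 x := besov_window_le1 x hw.
case: n => [|n] /=; last by rewrite w0 w1.
by do 2 ?case: ifP => _; rewrite ?w0 ?w1 ?ler01 ?lexx.
Qed.

(** For $n\ge 1$ the argument of [w] moves by at most $2^{-n}$. For $n=0$ both values lie in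
    $[0,1]$, which accounts for the constant [C + 1]. *)
Lemma besov_mult_step w : besov_window w ->
  exists2 C : R, 0 <= C & forall n (a b : nat),
    `|besov_mult w n (a.+1%:Z, b%:Z) - besov_mult w n (a%:Z,
      b%:Z)| <= C / 2 ^+ n.
Proof.
move=> hw; have [C C0 Clip] := besov_window_lipschitz hw.
exists (C + 1); first by rewrite addr_ge0.
move=> [|n] a b; last first.
  rewrite /=; apply: (le_trans (Clip _ _ _ _));
    rewrite ?divr_ge0 ?sqrtr_ge0 ?exprn_ge0//.
  have e0 : 0 <= (2 ^- n.+1 : R) by rewrite invr_ge0 exprn_ge0.
  rewrite -mulrBl normrM (ger0_norm e0).
  have aux (c d e : R) : 0 <= c -> 0 <= d <= 1 -> 0 <= e ->
      c * (d * e) <= (c + 1) * e.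
    by move=> c0 /andP[d0 d1] e1; rewrite mulrA ler_wpM2r//; nra.
  by apply: aux => //; rewrite normr_ge0 absZ2_step.
rewrite expr0 divr1.
have /andP[? ?] := besov_mult_bounds 0 (a.+1%:Z, b%:Z) hw.
have /andP[? ?] := besov_mult_bounds 0 (a%:Z, b%:Z) hw.
by rewrite ler_norml; apply/andP; split; lra.
Qed.

(** Here $|(a,b)|<2^{m+1}\le 2^n/2$, so [w] is evaluated below its support. *)
Lemma besov_mult_eq0 w n m (a b : nat) : besov_window w -> (m.+2 <= n)%N ->
  (a < 2 ^ m)%N -> (b < 2 ^ m)%N -> besov_mult w n (a%:Z, b%:Z) = 0.
Proof.
move=> hw mn am bm; case: n mn => // n mn; rewrite /=.
apply: (besov_window_eq0 hw); left.
rewrite ltr_pdivrMr ?exprn_gt0//.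
apply: (@lt_le_trans _ _ (2 ^+ m.+1)); last first.
  by rewrite [X in _ * X]exprS mulrA mulVf// mul1r ler_eXn2l// ltr1n.
rewrite -[ltRHS]ger0_norm ?exprn_ge0//
  -sqrtr_sqr ltr_sqrt ?exprn_gt0//= -!pmulrn.
have am' : (a%:R : R) < 2 ^+ m by rewrite -natrX ltr_nat.
have bm' : (b%:R : R) < 2 ^+ m by rewrite -natrX ltr_nat.
have a0 : 0 <= (a%:R : R) by [].
have b0 : 0 <= (b%:R : R) by [].
by rewrite (_ : 2 ^+ m.+1 = 2 * 2 ^+ m :> R) ?exprS//; nra.
Qed.
End WindowLipschitz.

(** * Sums over equally spaced points *)

Section HarmonicSums.
Context {R : realType}.

(* The harmonic number H_(n-1): the k = 0 term is the junk value 0^-1 = 0. *)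
Definition harm (n : nat) : R := \sum_(k < n) k%:R^-1.

Lemma harmS n : harm n.+1 = harm n + n%:R^-1.
Proof. by rewrite /harm big_ord_recr. Qed.

Lemma harm_ge0 n : 0 <= harm n.
Proof. by apply: sumr_ge0 => k _; rewrite invr_ge0. Qed.

Lemma harm_le m n : (m <= n)%N -> harm m <= harm n.
Proof.
move=> /subnK <-; elim: (n - m)%N => // k IH; rewrite addSn harmS.
by apply: (le_trans IH); rewrite lerDl invr_ge0.
Qed.

(** Subtraction is truncated and $0^{-1}=0$, so the terms with $b\le j$ vanish and the others are
    $1,1/2,\dots$ *)
Lemma sum_harm_subr n j : \sum_(b < n) (b - j)%:R^-1 <= harm n :> R.
Proof.
rewrite (_ : \sum_(_ < _) _ = harm (n - j));
  first by rewrite harm_le// leq_subr.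
elim: n => [|n IH]; first by rewrite /harm !big_ord0.
rewrite big_ord_recr /= IH; case: (leqP j n) => jn;
  first by rewrite subSn// harmS.
have -> : (n - j = 0)%N by lia.
have -> : (n.+1 - j = 0)%N by lia.
by rewrite invr0 addr0.
Qed.

Lemma sum_harm_subl n i : (i <= n)%N ->
  \sum_(b < n) (i - b)%:R^-1 <= harm n.+1 :> R.
Proof.
move=> i_n; apply: (@le_trans _ _ (harm i.+1)); last by rewrite harm_le.
(* The second summand is the part of the harmonic sum not yet reached after [n] terms; with it the
   identity holds for every [n], so induction on [n] works. *)
suff <- : \sum_(b < n) (i - b)%:R^-1 + harm (i - n).+1 = harm i.+1.
  by rewrite lerDl harm_ge0.
elim: n {i_n} => [|n IH]; first by rewrite big_ord0 add0r subn0.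
rewrite big_ord_recr /= -addrA -{}IH; congr (_ + _).
case: (leqP i n) => i_n.
  have -> : (i - n = 0)%N by lia.
  have -> : (i - n.+1 = 0)%N by lia.
  by rewrite invr0 add0r.
have -> : (i - n = (i - n.+1).+1)%N by lia.
by rewrite [in RHS]harmS addrC.
Qed.

(** Each dyadic block $2^m<k\le 2^{m+1}$ has $2^m$ terms, all at most $2^{-m}$, and contributes at
    most 1. *)
Lemma harm_pow2 m : harm (2 ^ m).+1 <= m.+1%:R.
Proof.
elim: m => [|m IH].
  by rewrite /harm !big_ord_recr big_ord0 /= invr0 invr1 !add0r.
rewrite -[m.+2%:R]natr1.
have aux k : harm (2 ^ m + k).+1 <= harm (2 ^ m).+1 + k%:R / 2 ^+ m.
  elim: k => [|k IHk]; first by rewrite addn0 mul0r addr0.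
  rewrite addnS harmS -[k.+1%:R]natr1 mulrDl mul1r addrA lerD//
    lef_pV2 ?posrE ?exprn_gt0//.
  by rewrite -natrX ler_nat; lia.
have := aux (2 ^ m)%N; rewrite natrX mulfV ?expf_neq0//.
by rewrite addnn -mul2n -expnS => h; apply: (le_trans h); rewrite lerD2r.
Qed.

End HarmonicSums.

Section SpikeSum.
Context {R : realType}.

(* Up to the three terms b = 0, i, i + 1 with i = floor(N x), the distance of
   x - b/N to the integers dominates one of the distances |i - b|/N, b/N,
   |b - i - 1|/N, (N - b)/N. *)
Lemma sum_spikes_le (N : nat) (x B : R) (G : nat -> R) : (0 < N)%N ->
  0 <= x < 1 -> 0 <= B ->
  (forall b, (b < N)%N -> G b <= 1) ->
  (forall b, (b < N)%N -> G b * (N%:R *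
     Num.min `|x - b%:R / N%:R| (1 - `|x - b%:R / N%:R|)) <= B) ->
  \sum_(b < N) G b <= 3 + 4 * B * harm N.+1.
Proof.
move=> N0 /andP[x0 x1] B0 G1 GB; pose i := Num.truncn (N%:R * x).
have N0' : (0 : R) < N%:R by rewrite ltr0n.
have /andP[ix xi] : i%:R <= N%:R * x < i.+1%:R by apply: truncn_itv;
  exact: mulr_ge0.
have iN : (i <= N)%N.
  by rewrite -(ler_nat R); apply: (le_trans ix); rewrite ler_piMr// ltW.
clearbody i; pose h (k : nat) : R := k%:R^-1.
have h0 k : 0 <= h k by rewrite invr_ge0.
(* From $gu\le B$ and $u\ge\min(p,q)$ one gets $g\le B\max(1/p,1/q)$; the sum of the reciprocals
   avoids keeping track of the case. *)
have bound (g u p q : R) : 0 < p -> 0 < q -> Num.min p q <= u -> g * u <= B ->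
    g <= B * (p^-1 + q^-1).
  move=> p0 q0 pqu guB; have ip0 : 0 < p^-1 by rewrite invr_gt0.
  have iq0 : 0 < q^-1 by rewrite invr_gt0.
  have [g0|/ltW g0] := leP g 0.
    by apply: (le_trans g0); rewrite mulr_ge0// addr_ge0// ltW.
  move: (le_trans (ler_wpM2l g0 pqu) guB); rewrite mulrDr.
  by case: (leP p q) => _; rewrite -ler_pdivlMr// => /le_trans; apply;
    rewrite ?lerDl ?lerDr mulr_ge0// ltW.
(* One bound valid for every [b]: the indicators cover the three exceptional terms, where
   [G b <= 1]. The first two reciprocals serve $b<i$, the last two $b>i+1$; all are nonnegative, so
   the remaining ones do no harm. *)
have GE b : (b < N)%N -> G b <=
    (b == 0%N)%:R + (b == i)%:R + (b == i.+1)%:R +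
    B * (h (i - b)%N + h (b - 0)%N + h (b - i.+1)%N + h (N - b)%N).
  move=> bN; have Gb1 := G1 b bN; have := GB b bN; rewrite subn0.
  set t := x - _ => Gt.
  have hB p q r s : B * (h p + h q + h r + h s) =
      B * (h p + h q) + B * (h r + h s) by ring.
  have B2 p q : 0 <= B * (h p + h q) by rewrite mulr_ge0// addr_ge0.
  rewrite hB; set X := B * _; set Y := B * _.
  have X0 : 0 <= X by exact: B2.
  have Y0 : 0 <= Y by exact: B2.
  set e0 := _%:R; set e1 := _%:R; set e2 := _%:R.
  have e00 : 0 <= e0 by exact: ler0n.
  have e10 : 0 <= e1 by exact: ler0n.
  have e20 : 0 <= e2 by exact: ler0n.
  have dominate : [\/ e0 = 1, e1 = 1, e2 = 1 | G b <= X \/ G b <= Y] ->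
      G b <= e0 + e1 + e2 + (X + Y).
    clearbody e0 e1 e2 X Y; move: (G b) Gb1 => g g1;
      clear - g1 e00 e10 e20 X0 Y0.
    by case=> [||| []]; lra.
  apply: dominate.
  have [b0|b0] := eqVneq b 0%N; first by apply: Or41; rewrite /e0 b0 eqxx.
  have [bi|bi] := eqVneq b i; first by apply: Or42; rewrite /e1 bi eqxx.
  have [bi1|bi1] := eqVneq b i.+1; first by apply: Or43; rewrite /e2 bi1 eqxx.
  apply: Or44.
  have Nt : N%:R * t = N%:R * x - b%:R by rewrite mulrBr mulrCA mulfV ?mulr1//
    gt_eqF.
  clearbody t; have [bi2|bi2] := ltnP b i.
    left.
    have t0 : 0 <= t.
      by rewrite -(pmulr_rge0 _ N0') Nt subr_ge0 (le_trans _ ix)// ler_nat ltnW.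
    apply: bound Gt; rewrite ?ltr0n ?subn_gt0 ?lt0n//.
    rewrite ger0_norm// minr_pMr// mulrBr mulr1 Nt (natrB _ (ltnW bi2)).
    rewrite le_min !ge_min; apply/andP; split; apply/orP; [left|right];
      first by lra.
    have : N%:R * x <= N%:R by rewrite ler_piMr// ltW.
    by lra.
  have bi3 : (i.+1 < b)%N by rewrite !ltn_neqAle ![_ == b]eq_sym bi1 bi bi2.
  right.
  have t0 : t <= 0.
    by rewrite -(pmulr_rle0 _ N0') Nt subr_le0 (le_trans (ltW xi))//
      ler_nat ltnW.
  apply: bound Gt; rewrite ?ltr0n ?subn_gt0//.
  rewrite ler0_norm// minr_pMr//
    opprK mulrDr mulrN mulr1 Nt (natrB _ (ltnW bi3)) (natrB _ (ltnW bN)).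
  rewrite le_min !ge_min; apply/andP; split; apply/orP; [left|right];
    first by lra.
  have : 0 <= N%:R * x by exact: mulr_ge0.
  by lra.
apply: le_trans; first by apply: ler_sum => b _; exact: GE.
have delta k : \sum_(b < N) ((b : nat) == k)%:R <= 1 :> R.
  have [kN|kN] := ltnP k N.
    rewrite (bigD1 (Ordinal kN))//= eqxx big1 ?addr0// => j jk.
    by rewrite (_ : (j == k :> nat) = false)//; apply/negbTE.
  by rewrite big1// => j _; rewrite ltn_eqF// (leq_trans (ltn_ord j)).
rewrite !big_split /= -mulr_sumr !big_split /=.
have := sum_harm_subl (R := R) iN; have := sum_harm_subr (R := R) N 0.
have := sum_harm_subr (R := R) N i.+1; have := sum_harm_subl (R := R) (leqnn N).
have := harm_le (R := R) (leqnSn N).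
have := delta 0%N; have := delta i; have := delta i.+1.
rewrite /h; set s1 := \sum_(b < N) _; set s2 := \sum_(b < N) _.
set s3 := \sum_(b < N) _; set s4 := \sum_(b < N) _; set s5 := \sum_(b < N) _.
set s6 := \sum_(b < N) _; set s7 := \sum_(b < N) _.
move=> d1 d2 d3 HH e1 e2 e3 e4.
have : B * (s7 + s6 + s5 + s4) <= B * (4 * harm N.+1) by rewrite ler_wpM2l//;
  lra.
by lra.
Qed.

End SpikeSum.

(** * The Besov norm of the test polynomial *)

Section BesovBound.
Context {R : realType}.
Implicit Types (w : R -> R).

Lemma abel_summation (m : nat -> R[i]) (z : R[i]) N :
  (1 - z) * \sum_(a < N) m a * z ^+ a =
  m 0%N - m N * z ^+ N + \sum_(a < N) (m a.+1 - m a) * z ^+ a.+1.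
Proof.
elim: N => [|N IH]; first by rewrite !big_ord0 expr0 mulr0 mulr1 subrr addr0.
by rewrite !big_ord_recr /= mulrDr IH !exprS; ring.
Qed.

(** With $\omega=e^{2\pi i/N}$ this is $N^{-1}\omega^{-ab}$. *)
Definition dft_coef N (a b : nat) : R[i] :=
  (N%:R^-1)%:C * circle (- (a%:R * (b%:R / N%:R))).

(** Exchanging the sums leaves, for each [b], a polynomial in [z b] whose modulus divided by [N] is
    [G b]. Trivially [G b <= 1], and Abel summation gives $N\,G(b)\,|1-z_b|\le 2+ND$; then
    [sum_spikes_le] applies with $B=2+ND$. *)
Lemma dft_conv_le w n N (D x y : R) : (0 < N)%N -> 0 <= x < 1 -> 0 <= D ->
  (forall j, 0 <= besov_mult w n j <= 1) ->
  (forall a b : nat, `|besov_mult w n (a.+1%:Z, b%:Z) - besov_mult w n (a%:Z,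
    b%:Z)|
     <= D) ->
  `|\sum_(a < N) \sum_(b < N) (besov_mult w n (a%:Z,
    b%:Z))%:C * dft_coef N a b *
    circle (a%:R * x + b%:R * y)| <= (3 + 4 * (2 + N%:R * D) * harm N.+1)%:C.
Proof.
move=> N0 x01 D0 m01 mD.
have N0' : (0 : R) < N%:R by rewrite ltr0n.
pose m (b a : nat) : R[i] := (besov_mult w n (a%:Z, b%:Z))%:C.
pose z b := circle (x - b%:R / N%:R).
pose g b : R[i] := (N%:R^-1)%:C * \sum_(a < N) m b a * z b ^+ a.
pose G b := complex.Re `|g b|.
have GE b : (G b)%:C = `|g b| by rewrite RRe_real// ger0_real.
have m1 b a : `|m b a| <= 1.
  by have /andP[? ?] := m01 (a%:Z, b%:Z);
    rewrite normc_def /= expr0n addr0 sqrtr_sqr lecR ger0_norm.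
have z1 b k : `|z b ^+ k| = 1 by rewrite normrX norm_circle expr1n.
have normN : `|(N%:R^-1)%:C| = (N%:R^-1)%:C :> R[i].
  by rewrite ger0_norm// lecR invr_ge0.
have -> : \sum_(a < N) \sum_(b < N) (besov_mult w n (a%:Z, b%:Z))%:C *
    dft_coef N a b * circle (a%:R * x + b%:R * y) =
    \sum_(b < N) circle (b%:R * y) * g b.
  rewrite exchange_big /=; apply: eq_bigr => b _.
  rewrite /g mulrCA mulr_sumr mulr_sumr; apply: eq_bigr => a _.
  rewrite /z circleX /m /dft_coef mulrBr circleD circleD; ring.
apply: (@le_trans _ _ (\sum_(b < N) (G b)%:C)).
  apply: (le_trans (ler_norm_sum _ _ _)); apply: ler_sum => b _.
  by rewrite normrM norm_circle mul1r GE.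
rewrite -raddf_sum lecR; apply: (@sum_spikes_le _ N x) => //.
- by rewrite addr_ge0// mulr_ge0.
- move=> b _; rewrite -lecR GE /g normrM normN.
  have -> : (1%:C : R[i]) = (N%:R^-1)%:C * \sum_(a < N) 1.
    by rewrite sumr_const card_ord -(rmorph_nat (real_complex R)) -rmorphM
      mulVf ?gt_eqF.
  rewrite ler_wpM2l// ?lecR ?invr_ge0//.
  apply: (le_trans (ler_norm_sum _ _ _)); apply: ler_sum => a _.
  by rewrite normrM z1 mulr1.
move=> b bN; set t := x - _.
have t1 : `|t| <= 1.
  have /andP[x0 x1] := x01; rewrite /t.
  have : 0 <= (b%:R / N%:R : R) <= 1.
    by apply/andP; split; [exact: divr_ge0 | rewrite ler_pdivrMr//
      mul1r ler_nat ltnW].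
  by move=> /andP[? ?]; rewrite ler_norml; apply/andP; split; lra.
set mn := Num.min _ _.
(* The chord is at least [2 * mn]; the factor 2 is given away. *)
have mn_le : mn%:C <= `|1 - z b|.
  apply: le_trans (norm_1Bcircle_ge t1); rewrite lecR.
  have : 0 <= mn by rewrite le_min normr_ge0 subr_ge0.
  by rewrite -/mn; lra.
rewrite -lecR !rmorphM /= GE.
apply: (@le_trans _ _ (`|g b| * (N%:R%:C * `|1 - z b|))).
  by rewrite ler_wpM2l// ler_wpM2l// lecR.
rewrite mulrA {1}/g normrM normN [X in X * _]mulrAC -rmorphM mulVf ?gt_eqF//
  mul1r.
rewrite mulrC -normrM abel_summation.
apply: (le_trans (ler_normD _ _)); rewrite raddfD lerD//.
  apply: (le_trans (ler_normB _ _)); rewrite normrM z1 mulr1.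
  by rewrite -[2]/(1 + 1) raddfD lerD ?m1.
apply: (le_trans (ler_norm_sum _ _ _)).
apply: (@le_trans _ _ (\sum_(a < N) D%:C)); last first.
  by rewrite sumr_const card_ord -raddfMn lecR mulr_natl.
apply: ler_sum => a _; rewrite normrM z1 mulr1 /m -rmorphB normc_def /= expr0n
  addr0.
by rewrite sqrtr_sqr lecR.
Qed.

End BesovBound.

Section BesovNorm.
Context {R : realType}.
Implicit Types (w : R -> R).

Lemma torus_Linfty_le (g : R[i] -> R[i] -> R[i]) (B : R) : 0 <= B ->
  (forall s t, `|g (circle s) (circle t)| <= B%:C) -> (torus_Linfty g <=
    B%:E)%E.
Proof.
move=> B0 gB; rewrite /torus_Linfty unlock; case: ifP => _;
  last by rewrite lee_fin.
apply/ess_supP; apply: aeW => -[s t] /=.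
have ReE : (complex.Re `|g (circle s) (circle t)|)%:C = `|g (circle s) (circle
  t)|.
  by rewrite RRe_real ?ger0_real.
have Re0 : 0 <= complex.Re `|g (circle s) (circle t)| by rewrite -lecR ReE
  normr_ge0.

by rewrite lee_fin (ger0_norm Re0) -lecR ReE.
Qed.

Lemma torus_Linfty_ge0 (g : R[i] -> R[i] -> R[i]) : (0 <= torus_Linfty g)%E.
Proof. exact: Lnorm_ge0. Qed.

(** The fractional part serves; it brings the first coordinate into the range demanded by
    [dft_conv_le]. *)
Lemma circle_fract (x : R) : exists2 y, 0 <= y < 1 & circle y = circle x.
Proof.
exists (x - (Num.floor x)%:~R).
  have /andP[] := floor_itv x; rewrite intrD => ? ?.
  by apply/andP; split; lra.
by rewrite circleD circleN circle_int invr1 mulr1.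
Qed.

(** Only the blocks $n\le m+1$ survive, and each of these [m.+2] blocks is $O(2^m(m+2))$, one
    logarithmic factor coming from the harmonic sum. *)
Lemma besov_norm_dft w : besov_window w -> exists2 K : R, 0 <= K &
  forall m, (besov_norm w (poly2 (2 ^ m) (dft_coef (2 ^ m))) <=
    (K * 2 ^+ m * m.+2%:R ^+ 2)%:E)%E.
Proof.
move=> hw; have [C C0 mC] := besov_mult_step hw.
(* With $2^n\le 2\cdot 2^m$, the terms $3\cdot 2^n$ and $8\cdot 2^n$ give $6+16=22$; the Lipschitz
   term gives $4C$. *)
exists (22 + 4 * C); first by rewrite addr_ge0// mulr_ge0.
move=> m; rewrite /besov_norm; set f := poly2 _ _.
have conv0 n : (m.+2 <= n)%N ->
    torus_Linfty (torus_conv (fun z1 z2 =>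
      f.[z1, z2]) (besov_kernel w n)) = 0%E.
  move=> mn; apply/eqP; rewrite eq_le torus_Linfty_ge0 andbT.
  apply: torus_Linfty_le => // s t; rewrite besov_conv// big1 ?normr0// => a _.
  by rewrite big1// => b _; rewrite (besov_mult_eq0 hw mn)// !mul0r.
rewrite (@nneseries_finite _ _ m.+2) => [|n|n mn]; last 2 first.
- by rewrite mule_ge0 ?torus_Linfty_ge0// lee_fin exprn_ge0.
- by rewrite conv0// mule0.
have e0 k : 0 < (2 : R) ^+ k by rewrite exprn_gt0.
have term n : (n < m.+2)%N ->
    ((2 ^+ n)%:E * torus_Linfty (torus_conv (fun z1 z2 => f.[z1, z2])
      (besov_kernel w n)) <= ((22 + 4 * C) * 2 ^+ m * m.+2%:R)%:E)%E.
  move=> nm; have D0 : 0 <= C / 2 ^+ n by rewrite divr_ge0// ltW.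
  set B := 3 + 4 * (2 + (2 ^ m)%:R * (C / 2 ^+ n)) * harm (2 ^ m).+1 : R.
  have H0 := @harm_ge0 R (2 ^ m).+1; have Hm := @harm_pow2 R m.
  have nat0 : 0 <= (2 ^ m)%:R :> R by [].
  have B0 : 0 <= B by rewrite addr_ge0// !mulr_ge0// addr_ge0// mulr_ge0.
  apply: (@le_trans _ _ ((2 ^+ n)%:E * B%:E)%E).
    rewrite lee_pmul2l ?lte_fin//; apply: torus_Linfty_le => // s t.
    have [s' s'01 <-] := circle_fract s.
    rewrite besov_conv//; apply: dft_conv_le => //.
    - by rewrite expn_gt0.
    - by move=> j; exact: besov_mult_bounds.
  rewrite -EFinM lee_fin /B natrX.
  have n2 : (2 : R) ^+ n <= 2 * 2 ^+ m by rewrite -exprS ler_eXn2l// ltr1n.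
  have -> : 2 ^+ n * (3 + 4 * (2 + 2 ^+ m * (C / 2 ^+ n)) * harm (2 ^ m).+1) =
      3 * 2 ^+ n + (8 * 2 ^+ n + 4 * C * 2 ^+ m) * harm (2 ^ m).+1 :> R.
    by field; rewrite gt_eqF.
  rewrite -[m.+2%:R]natr1.
  have m1 : 1 <= m.+1%:R :> R by rewrite ler1n.
  have em := e0 m; have en := e0 n.
  set e := 2 ^+ m in n2 em *; set d := 2 ^+ n in n2 en *.
  have h1 : (8 * d + 4 * C * e) * harm (2 ^ m).+1 <= (16 * e + 4 * C * e) *
    m.+1%:R.
    by apply: ler_pM; rewrite ?addr_ge0 ?mulr_ge0//; nra.
  apply: (le_trans (lerD (lexx _) h1)).
  have Ce : 0 <= C * e by rewrite mulr_ge0// ltW.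
  by nra.
rewrite big_mkord; apply: le_trans.
  by apply: lee_sum => n _; exact: term.
by rewrite sumEFin sumr_const card_ord lee_fin -[leLHS]mulr_natr expr2 mulrA.
Qed.
End BesovNorm.

(** * Clock and shift operators *)

Section DiagShift.
Context {R : realType} {N : nat}.
Local Notation H := (ell2_hilbert R N).
Implicit Types (d : 'I_N -> R[i]) (x y : ell2 R N).

Definition diag_op d x : ell2 R N := \row_i (d i * x 0 i).
(** As [ord_pred] is the cyclic predecessor, this sends $e_k$ to $e_{k+1}$, indices modulo [N]. *)
Definition shift_op x : ell2 R N := \row_i x 0 (ord_pred i).

Lemma diag_op_linear d : linear (diag_op d).
Proof. by move=> a x y; apply/rowP => i; rewrite !mxE; ring. Qed.

Lemma shift_op_linear : linear shift_op.
Proof. by move=> a x y; apply/rowP => i; rewrite !mxE. Qed.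

HB.instance Definition _ d :=
  GRing.isLinear.Build R[i] (ell2 R N) (ell2 R N) *:%R (diag_op d)
    (diag_op_linear d).
HB.instance Definition _ :=
  GRing.isLinear.Build R[i] (ell2 R N) (ell2 R N) *:%R shift_op shift_op_linear.

Definition diagH d : {linear H -> H} := diag_op d.
Definition shiftH : {linear H -> H} := shift_op.

Lemma diagH_unitary d : (forall i, `|d i| = 1) -> unitary (diagH d).
Proof.
move=> d1; split=> [x y|y].
  apply: eq_bigr => i _; rewrite !mxE rmorphM /= mulrACA.
  by rewrite -normCK d1 expr1n mul1r.
exists (diag_op (fun i => (d i)^-1) y); apply/rowP => i.
by rewrite !mxE mulrA mulfV ?mul1r// -normr_gt0 d1.
Qed.

Lemma shiftH_unitary : unitary shiftH.
Proof.
split=> [x y|y].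
  rewrite /hdot/= /ell2_dot [RHS](reindex_inj (@ord_pred_inj N)) /=.
  by apply: eq_bigr => i _; rewrite !mxE.
by exists (\row_i y 0 (ordS i)); apply/rowP => i; rewrite !mxE ord_predK.
Qed.

Lemma iter_diagH d k x i : (iter k (diagH d) x : ell2 R N) 0 i = d i ^+ k * x 0
  i.
Proof.
elim: k => [|k IH]; first by rewrite expr0 mul1r.
by rewrite iterS /= mxE IH exprS mulrA.
Qed.

Definition basis_vec (k : nat) : ell2 R N := \row_i ((i : nat) == k)%:R.

Lemma iter_shiftH k : (k < N)%N -> iter k shiftH (basis_vec 0) = basis_vec k.
Proof.
elim: k => // k IH kN; rewrite iterS IH; last exact: ltnW.
apply/rowP => -[i iN]; rewrite !mxE /=; congr (_%:R); congr nat_of_bool.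
case: i iN => [|i] iN.
  by rewrite add0n modn_small ?prednK ?(leq_ltn_trans _ kN)// gtn_eqF//; lia.
by rewrite addSn /= modnDr modn_small ?eqSS// ltnW.
Qed.

Lemma diagH_norm_le d (c : R) x : 0 <= c -> (forall i, `|d i| <= c%:C) ->
  `|diag_op d x| <= c%:C * `|x|.
Proof.
move=> c0 dc; rewrite -ler_sqr ?nnegrE ?mulr_ge0 ?lecR// exprMn !ell2_norm_sqrE.
rewrite mulr_sumr; apply: ler_sum => i _.
rewrite mxE normrM exprMn ler_wpM2r ?exprn_ge0 ?normr_ge0//.
apply: lerXn2r; last exact: dc.
- by rewrite nnegrE normr_ge0.
- by rewrite nnegrE ler0c.
Qed.

Lemma ell2_rank_le (T : H -> H) : rank_le N T.
Proof.
exists (fun i => delta_mx 0 i) => x; exists (fun i => (T x : ell2 R N) 0 i).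
exact: row_sum_delta.
Qed.

End DiagShift.

(** The sums in [poly_op] stop at the actual sizes, which may be below [N]; the terms added up to
    [N] have zero coefficients. *)
Lemma poly_op_poly2 (R : realType) (H : hilbertSpace R) N c
    (U V : {linear H -> H}) x :
  poly_op (@poly2 R N c) U V x =
  \sum_(a < N) \sum_(b < N) c a b *: iter a U (iter b V x).
Proof.
rewrite /poly_op; set f := poly2 N c.
pose F a : H := \sum_(k < size f`_a) f`_a`_k *: iter a U (iter k V x).
have sf : (size f <= N)%N by exact: size_poly.
rewrite (big_ord_widen N F sf) big_mkcond; apply: eq_bigr => a _ /=.
have fa : f`_a = \poly_(b < N) c a b by rewrite coef_poly ltn_ord.
have -> : (if (a < size f)%N then F a else 0) = F a.
  case: ltnP => // fa0; rewrite /F nth_default//.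
  by rewrite size_poly0 big_ord0.
rewrite /F fa; set g := \poly_(b < N) _.
rewrite (big_ord_widen N (fun k =>
  g`_k *: iter a U (iter k V x)) (size_poly _ _)).
rewrite big_mkcond; apply: eq_bigr => b _ /=.
case: ltnP => [_|gb]; first by rewrite coef_poly ltn_ord.
have := nth_default 0 gb; rewrite coef_poly ltn_ord => ->.
by rewrite scale0r.
Qed.

(** * The test operators and their Schatten norms *)

Section TestOperators.
Context {R : realType} (N : nat).
Local Notation H := (ell2_hilbert R N).

(** This is $\omega^k\,\mathrm{diag}(\omega^i)$: [clock 0] is $U_1$ and [clock 1] is $U_2$. *)
Definition clock (k : nat) : {linear H -> H} :=
  diagH (fun i : 'I_N => circle ((i + k)%:R / N%:R : R)).

Lemma clock_unitary k : unitary (clock k).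
Proof. by apply: diagH_unitary => i; exact: norm_circle. Qed.

(** Since $V^b e_0=e_b$, coordinate [i] only sees $b=i$; the coefficient $\omega^{-ai}$ then cancels
    against $\omega^{a(i+k)}$, leaving $\omega^{ak}$. *)
Lemma poly_op_clock k :
  poly_op (poly2 N (@dft_coef R N)) (clock k) shiftH (basis_vec 0) =
  \row_i (N%:R^-1%:C * \sum_(a < N) circle (k%:R / N%:R) ^+ a) :> ell2 R N.
Proof.
rewrite poly_op_poly2; apply/rowP => i; rewrite summxE mxE mulr_sumr.
apply: eq_bigr => a _; rewrite summxE (bigD1 i)//= big1 ?addr0.
  rewrite iter_shiftH// mxE iter_diagH mxE eqxx mulr1 /dft_coef -mulrA;
    congr (_ * _).
  by rewrite !circleX -circleD natrD; congr circle; ring.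
move=> b bi; rewrite iter_shiftH// mxE iter_diagH mxE.
by rewrite (_ : (i == b :> nat) = false) ?mulr0//; apply/negbTE; rewrite eq_sym.
Qed.

(** Tested on the unit vector $e_0$, the difference yields the all-ones vector, of norm $\sqrt
    N$. *)
Lemma schatten_clock_diff_poly p : (1 < N)%N -> (0 < p)%E ->
  ((Num.sqrt N%:R)%:E <= schatten_norm p (fun x : H =>
    (poly_op (poly2 N (@dft_coef R N)) (clock 0) shiftH x -
     poly_op (poly2 N (@dft_coef R N)) (clock 1) shiftH x)%R))%E.
Proof.
move=> N1 p0; apply: le_trans (schatten_norm_ge_opnorm _ p0).
have N0 : (0 < N)%N by exact: ltnW.
have N0' : N%:R != 0 :> R by rewrite pnatr_eq0 -lt0n.
apply: (@opnorm_ge R H _ (basis_vec 0 : ell2 R N)).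
  rewrite -(@expr_le1 _ 2)// ell2_norm_sqrE (bigD1 (Ordinal N0))//= big1 =>
    [|i iN].
    by rewrite mxE normr1 expr1n addr0.
  by rewrite mxE (_ : (i == 0 :> nat)%N = false) ?normr0 ?expr0n//;
    apply/negbTE.
rewrite !poly_op_clock; set v := _ - _.
have -> : v = \row_i 1.
  apply/rowP => i; rewrite !mxE.
  under eq_bigr do rewrite mul0r circle0 expr1n.
  rewrite sumr_const card_ord -(rmorph_nat (real_complex R)) -rmorphM mulVf//.
  under [X in _ - _ * X]eq_bigr do rewrite circleX mulrA mulr1.
  by rewrite sum_circle// mulr0 subr0.
rewrite -(@ler_pXn2r _ 2) ?nnegrE ?ler0c ?sqrtr_ge0//.
rewrite -rmorphXn /= sqr_sqrtr// ell2_norm_sqrE.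
under eq_bigr do rewrite mxE normr1 expr1n.
by rewrite sumr_const card_ord rmorph_nat.
Qed.

Lemma clock_diffE : (fun x : H => (clock 0 x - clock 1 x)%R) =
  diagH (fun i : 'I_N => circle ((i + 0)%:R / N%:R) - circle ((i + 1)%:R /
    N%:R)).
Proof. by apply/funext => x; apply/rowP => i; rewrite !mxE mulrBl. Qed.

Lemma clock_diff_le (x : H) :
  `|diagH (fun i : 'I_N => circle ((i + 0)%:R / N%:R) - circle ((i + 1)%:R /
    N%:R)) x|
  <= (8 / N%:R)%:C * `|x|.
Proof.
apply: diagH_norm_le => [|i]; first by rewrite divr_ge0.
rewrite addn0 natrD mulrDl circleD -[X in X - _]mulr1 -mulrBr normrM
  norm_circle mul1r.
by apply: (le_trans (norm_1Bcircle_le _)); rewrite div1r ger0_norm ?invr_ge0.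
Qed.

End TestOperators.

(** Here $q=1/p$, read as 0 for $p=\infty$; the rank is at most [N] and the operator norm at most
    $8/N$. The assumption $p>2$ enters as $q<1/2$. *)
Lemma schatten_clock_diff (R : realType) (p : \bar R) : (2%:E < p)%E ->
  exists2 q : R, 0 <= q < 2^-1 & forall N, (1 < N)%N ->
  (schatten_norm p (fun x : ell2_hilbert R N =>
    (clock N 0 x - clock N 1 x)%R) <=
    (N%:R `^ q * (8 / N%:R))%:E)%E.
Proof.
case: p => [r||] //.
  rewrite lte_fin => r2; have r0 : 0 < r by lra.
  exists r^-1; first by apply/andP; split;
    [rewrite invr_ge0 ltW | rewrite ltf_pV2 ?posrE].
  move=> N N1; rewrite clock_diffE.
  apply: (@schatten_norm_le_rank _ _ r (8 / N%:R)) => //.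
  - exact: clock_diff_le.
  - exact: ell2_rank_le.
move=> _; exists 0; first by rewrite lexx /= invr_gt0.
move=> N N1; rewrite clock_diffE powRr0 mul1r.
apply: opnorm_le; first by rewrite divr_ge0.
exact: clock_diff_le.
Qed.

(** Writing $2^{md}$ as the cube of $\exp(dm\ln 2/3)$ and using $e^x\ge 1+x$ produces a cubic lower
    bound in $m+2$. *)
Lemma pow2_beats_square (R : realType) (A d : R) : 0 <= A -> 0 < d ->
  exists2 m : nat, (0 < m)%N & A * m.+2%:R ^+ 2 < (2 ^+ m) `^ d.
Proof.
move=> A0 d0; have ln2 : 0 < ln 2 :> R by rewrite ln_gt0// ltr1n.
(* The bound $k\le 1/2$ gives $2k\le 1$, hence $k(m+2)\le 1+(d\ln 2/3)m$. *)
pose k := Num.min (d * ln 2 / 3) 2^-1.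
have k0 : 0 < k by rewrite lt_min invr_gt0 ltr0n andbT divr_gt0// mulr_gt0.
have k3 : 0 < k ^+ 3 by rewrite exprn_gt0.
(* This choice forces $A<k^3(m+2)$, so that $A(m+2)^2<(k(m+2))^3$. *)
exists (Num.truncn (A / k ^+ 3)).+1 => //; set m := (Num.truncn _).+1.
have Am : A < k ^+ 3 * m.+2%:R.
  rewrite mulrC -ltr_pdivrMr//; apply: (@lt_le_trans _ _ m%:R);
    last by rewrite ler_nat (leqW (leqnSn m)).
  exact: truncnS_gt.
clearbody m; have -> : (2 ^+ m : R) `^ d = expR (d * ln 2 / 3 * m%:R) ^+ 3.
  rewrite -expRM_natr /powR gt_eqF ?exprn_gt0// lnXn// -mulr_natl.
  by congr expR; field.
have kd : k <= d * ln 2 / 3 by rewrite ge_min lexx.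
have k2 : k <= 2^-1 by rewrite ge_min lexx orbT.
have m0 : 0 <= m%:R :> R by [].
have m2 : m.+2%:R = m%:R + 2 :> R by rewrite -addn2 natrD.
have base : k * m.+2%:R <= expR (d * ln 2 / 3 * m%:R).
  apply: le_trans (expR_ge1Dx _); rewrite m2.
  by have := ler_wpM2r m0 kd; lra.
have kb0 : 0 <= k * m.+2%:R by rewrite mulr_ge0// ltW.
apply: (@lt_le_trans _ _ ((k * m.+2%:R) ^+ 3)); last first.
  by apply: lerXn2r base; rewrite nnegrE ?expR_ge0.
have mm0 : 0 < m.+2%:R ^+ 2 :> R by rewrite exprn_gt0.
have -> : (k * m.+2%:R) ^+ 3 = k ^+ 3 * m.+2%:R * m.+2%:R ^+ 2 by ring.
by rewrite ltr_pM2r.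
Qed.

Theorem theorem7p3 (R : realType) (w : R -> R) (hw : besov_window w)
    (M : R) (hM : 0 < M) (p : \bar R) (hp : (2%:E < p)%E) :
  exists (H : hilbertSpace R) (U1 U2 V : {linear H -> H})
         (f : {poly {poly R[i]}}),
    [/\ unitary U1, unitary U2, unitary V &
        (M%:E * besov_norm w f * schatten_norm p (fun x => (U1 x - U2 x)%R) <
         schatten_norm p (fun x => (poly_op f U1 V x - poly_op f U2 V x)%R))%E].
Proof.
have [K K0 besovK] := besov_norm_dft hw.
have [q /andP[q0 q2] schattenq] := schatten_clock_diff hp.
(* The factor 8 comes from the norm of $U_1-U_2$ and [K] from the Besov norm; the exponent $1/2-q$
   is what remains of $\sqrt N$ after removing $N^q$. *)
have [||m m0 mA] := @pow2_beats_square R (8 * M * K) (2^-1 - q).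
- by rewrite !mulr_ge0// ltW.
- by rewrite subr_gt0.
set N := (2 ^ m)%N.
have N1 : (1 < N)%N by rewrite -(expn0 2) ltn_exp2l.
exists (ell2_hilbert R N), (clock N 0), (clock N 1), shiftH,
  (poly2 N (dft_coef N)).
split; [exact: clock_unitary | exact: clock_unitary | exact: shiftH_unitary |].
have p0 : (0 < p)%E by exact: lt_trans hp.
apply: lt_le_trans (schatten_clock_diff_poly N1 p0).
have NE : N%:R = 2 ^+ m :> R by rewrite natrX.
have e0 : 0 < 2 ^+ m :> R by rewrite exprn_gt0.
apply: (@le_lt_trans _ _
   ((M * (K * 2 ^+ m * m.+2%:R ^+ 2) * (N%:R `^ q * (8 / N%:R)))%:E)).
  rewrite !EFinM; apply: lee_pmul.
  - apply: mule_ge0; first by rewrite lee_fin ltW.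
    apply: nneseries_ge0 => n _ _.
    by rewrite mule_ge0 ?torus_Linfty_ge0// lee_fin exprn_ge0.
  - by apply: le_trans (opnorm_ge0 _) _; exact: schatten_norm_ge_opnorm.
  - by rewrite lee_pmul2l ?lte_fin// besovK.
  - by rewrite -EFinM schattenq.
rewrite lte_fin NE -powR12_sqrt ?ltW//.
(* Splitting the exponent lets $N^q$ cancel, leaving the inequality [mA]. *)
have -> : 2^-1 = q + (2^-1 - q) by rewrite addrC subrK.
rewrite powRD; last by rewrite (gt_eqF e0) implybT.
have -> : M * (K * 2 ^+ m * m.+2%:R ^+ 2) * ((2 ^+ m) `^ q * (8 / 2 ^+ m)) =
    (2 ^+ m) `^ q * (8 * M * K * m.+2%:R ^+ 2) by field; rewrite gt_eqF.
by rewrite ltr_pM2l// powR_gt0.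
Qed.
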